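(* Let $\mathfrak g=\mathfrak g(\gamma,Q)$ with $\gamma$ generic. Let $\mathrm{Der}\,\mathfrak g$ be the Lie algebra of derivations of $\mathfrak g$ and, for $\mathbf n\in\mathbb Z^d$, let $(\mathrm{Der}\,\mathfrak g)_{\mathbf n}$ be the space of derivations $D$ of degree $\mathbf n$, i.e. with $D(L_{\mathbf m})\in\mathbb C L_{\mathbf m+\mathbf n}$ for all $\mathbf m\in\mathbb Z^d$. Then $$\mathrm{Der}\,\mathfrak g=\bigoplus_{\mathbf n\in\mathbb Z^d}(\mathrm{Der}\,\mathfrak g)_{\mathbf n},\qquad (\mathrm{Der}\,\mathfrak g)_{\mathbf n}=\begin{cases}\mathrm{span}_{\mathbb C}\{\partial_1,\partial_2,\dots,\partial_d\},&\text{if }\mathbf n=\mathbf 0;\\ \mathrm{span}_{\mathbb C}\{\mathrm{ad}\,L_{\mathbf n}\},&\text{if }\mathbf n\ne\mathbf 0,\end{cases}$$ where $\partial_i:\mathfrak g\to\mathfrak g$ ($1\le i\le d$) is the linear map with $\partial_i(L_{\mathbf m})=m_iL_{\mathbf m}$ for $\mathbf m=(m_1,\dots,m_d)\in\mathbb Z^d$.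
   Context: Let $d>1$ be an integer, $\gamma=(\gamma_1,\dots,\gamma_d)\in\mathbb C^d$, and $Q=(q_{ij})$ a $d\times d$ complex matrix with $q_{ii}=1$ and $q_{ij}q_{ji}=1$ for all $i,j$. The vector $\gamma$ is called generic if $\gamma_1,\dots,\gamma_d$ are linearly independent over $\mathbb Q$. For $\mathbf m=(m_1,\dots,m_d),\mathbf n=(n_1,\dots,n_d)\in\mathbb Z^d$ put $$\sigma(\mathbf m,\mathbf n)=\prod_{1\le i<j\le d}q_{ji}^{m_jn_i},\qquad R=\{\mathbf m\in\mathbb Z^d\mid \sigma(\mathbf m,\mathbf n)=\sigma(\mathbf n,\mathbf m)\text{ for all }\mathbf n\in\mathbb Z^d\},$$ and $(\gamma\mid\mathbf n)=\sum_{i=1}^d\gamma_in_i$. The complex Lie algebra $\mathfrak g(\gamma,Q)$ has basis $\{L_{\mathbf m}\mid\mathbf m\in\mathbb Z^d\}$ and brackets $$[L_{\mathbf m},L_{\mathbf n}]=\sigma(\mathbf m,\mathbf n)(\gamma\mid\mathbf n-\mathbf m)L_{\mathbf m+\mathbf n},\quad [L_{\mathbf m},L_{\mathbf s}]=\sigma(\mathbf m,\mathbf s)(\gamma\mid\mathbf s)L_{\mathbf m+\mathbf s},\quad [L_{\mathbf r},L_{\mathbf s}]=(\sigma(\mathbf r,\mathbf s)-\sigma(\mathbf s,\mathbf r))L_{\mathbf r+\mathbf s}$$ for $\mathbf m,\mathbf n\in R$ and $\mathbf r,\mathbf s\in\mathbb Z^d\setminus R$. *)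

(* Defs.v *)
From HB Require Import structures.
From mathcomp Require Import all_boot all_order all_algebra finmap.
From mathcomp Require Import boolp classical_sets functions reals.
From mathcomp Require Import complex monalg ring.

Set Implicit Arguments.
Unset Strict Implicit.
Unset Printing Implicit Defensive.

Import GRing.Theory Num.Theory.

Local Open Scope classical_set_scope.
Local Open Scope ring_scope.

Section LinearAlgebra.
Context {F : fieldType} {V : lmodType F}.

Definition is_subspace (A : set V) : Prop := submod_closed [in A].

Definition lspan (A : set V) : set V :=
  [set v | exists (s : seq V) (c : V -> F),
     (forall u, u \in s -> A u) /\ v = \sum_(u <- s) c u *: u].

(* A is the internal direct sum of the family B: both conditions are over
   finite subfamilies, so the index type I may be infinite. *)
Definition is_direct_sum (I : choiceType) (A : set V) (B : I -> set V) : Prop :=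
  [/\ is_subspace A,
      forall i, is_subspace (B i),
      A = [set v | exists (s : {fset I}) (b : I -> V),
             (forall i, B i (b i)) /\ v = \sum_(i <- s) b i]
    & forall (s : {fset I}) (b : I -> V), (forall i, B i (b i)) ->
        \sum_(i <- s) b i = 0 -> forall i, i \in s -> b i = 0].

Definition bilinear_bracket (br : V -> V -> V) : Prop :=
  (forall x, linear (br x)) /\ (forall y, linear (br^~ y)).

Definition is_lie_bracket (br : V -> V -> V) : Prop :=
  [/\ bilinear_bracket br,
      forall x, br x x = 0
    & forall x y z, br x (br y z) + br y (br z x) + br z (br x y) = 0].

Definition derivation (br : V -> V -> V) : set (V -> V) :=
  [set D | linear D /\ forall x y, D (br x y) = br (D x) y + br x (D y)].

Lemma derivation_commutator (br : V -> V -> V) (D1 D2 : V -> V) :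
  bilinear_bracket br -> derivation br D1 -> derivation br D2 ->
  derivation br (fun x => D1 (D2 x) - D2 (D1 x)).
Proof.
move=> [lr ll] [l1 d1] [l2 d2].
have add (f : V -> V) : linear f -> forall x y, f (x + y) = f x + f y.
  by move=> lf x y; have := lf 1 x y; rewrite !scale1r.
have sub (f : V -> V) : linear f -> forall x y, f (x - y) = f x - f y.
  move=> lf x y; have := lf (-1) y x.
  by rewrite !scaleN1r => fE; rewrite addrC fE addrC.
split=> [a x y | x y].
  by rewrite l2 l1 l1 l2 scalerBr opprD addrACA.
rewrite (sub _ (lr x)) (sub _ (ll y)) d1 d2 (add _ l1) (add _ l2) !d1 !d2.
set u := br (D1 (D2 x)) y; set v := br (D2 (D1 x)) y.
set w := br x (D1 (D2 y)); set z := br x (D2 (D1 y)).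
set e := br (D1 x) (D2 y); set g := br (D2 x) (D1 y).
rewrite (addrC e w) (addrACA u) (addrC g z) (addrACA v).
by rewrite opprD (addrACA (u + w)) (addrC e g) subrr addr0 opprD addrACA.
Qed.

End LinearAlgebra.

(* {malg F[K]} is the F-vector space with basis << k >>, k in K. *)
Definition malg_linear (F : fieldType) (K : choiceType) (V : lmodType F)
    (f : K -> V) (x : {malg F[K]}) : V :=
  \sum_(k <- msupp x) x@_k *: f k.

Lemma linear_scale (F : fieldType) (V W : lmodType F) (f : V -> W) :
  linear f -> forall a x, f (a *: x) = a *: f x.
Proof.
move=> lf a x; have f0 : f 0 = 0.
  by have := lf (-1) 0 0; rewrite scaler0 addr0 scaleN1r addNr.
by have := lf a x 0; rewrite !addr0 f0 addr0.
Qed.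

Section MalgLinear.
Context {F : fieldType} {K : choiceType} {V : lmodType F}.
Implicit Types (f : K -> V) (x : {malg F[K]}).

Lemma malg_linearEw f x (E : {fset K}) : fsubset (msupp x) E ->
  malg_linear f x = \sum_(k <- E) x@_k *: f k.
Proof.
move=> sE; rewrite /malg_linear; apply: big_fset_incl => //= k _ kx.
by rewrite mcoeff_outdom // scale0r.
Qed.

Lemma malg_linear_linear f : linear (malg_linear f).
Proof.
move=> a x y; pose E := fsetU (msupp (a *: x + y)) (fsetU (msupp x) (msupp y)).
rewrite !(@malg_linearEw _ _ E); try by
  apply/fsubsetP => k; rewrite !inE => ->; rewrite ?orbT.
rewrite scaler_sumr -big_split /=; apply: eq_bigr => k _.
by rewrite mcoeffD mcoeffZ scalerDl scalerA.
Qed.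

Lemma malg_linear_fun a (f g : K -> V) x :
  malg_linear (fun k => a *: f k + g k) x = a *: malg_linear f x + malg_linear g x.
Proof.
rewrite /malg_linear scaler_sumr -big_split; apply: eq_bigr => k _ /=.
by rewrite scalerDr !scalerA mulrC.
Qed.

Lemma malg_linearU f k : malg_linear f << k >> = f k.
Proof.
rewrite (@malg_linearEw _ _ [fset k]%fset) ?msuppU_le //.
by rewrite big_seq_fset1 mcoeffUU scale1r.
Qed.

Lemma malg_linear_ext (g h : {malg F[K]} -> V) :
  linear g -> linear h -> (forall k, g << k >> = h << k >>) -> g =1 h.
Proof.
move=> lg lh gh x.
have lsum (u : {malg F[K]} -> V) : linear u ->
    u x = \sum_(k <- msupp x) x@_k *: u << k >>.
  move=> lu; have u0 : u 0 = 0.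
    by have := lu (-1) 0 0; rewrite scaler0 addr0 scaleN1r addNr.
  have {1}-> : x = \sum_(k <- msupp x) x@_k *: << k >>.
    rewrite [LHS](@monalgEw _ _ x (msupp x)) ?fsubset_refl //.
    by apply: eq_bigr => k _; apply/malgP => k'; rewrite mcoeffZ !mcoeffU
      mulr_natr.
  by elim: (enum_fset _) => [|k s IH]; rewrite ?big_nil // !big_cons lu IH.
by rewrite (lsum _ lg) (lsum _ lh); apply: eq_bigr => k _; rewrite gh.
Qed.

End MalgLinear.

Lemma basis_lie_bracket (F : numFieldType) (K : zmodType)
    (br : {malg F[K]} -> {malg F[K]} -> {malg F[K]}) (c : K -> K -> F) :
  bilinear_bracket br ->
  (forall m n, br << m >> << n >> = c m n *: << m + n >>) ->
  (forall m n, c m n = - c n m) ->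
  (forall m n k, c n k * c m (n + k) + c k m * c n (k + m)
                 + c m n * c k (m + n) = 0) ->
  is_lie_bracket br.
Proof.
move=> [lr ll] brE canti cjac; pose gspace := {malg F[K]}.
have lin0 (f : gspace -> gspace) : linear f -> linear (fun x => - f x).
  by move=> lf a x y; rewrite lf opprD scalerN.
have linD (f g : gspace -> gspace) :
    linear f -> linear g -> linear (fun x => f x + g x).
  by move=> lf lg a x y; rewrite lf lg scalerDr addrACA.
have linC (f g : gspace -> gspace) :
    linear f -> linear g -> linear (fun x => f (g x)).
  by move=> lf lg a x y; rewrite lg lf.
have linZ0 : linear (fun _ : gspace => 0 : gspace).
  by move=> a x y; rewrite scaler0 addr0.
have brZr a x y : br x (a *: y) = a *: br x y.
  exact: linear_scale.
have anti x y : br x y = - br y x.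
  move: x; apply: malg_linear_ext; [exact: ll | exact: lin0 | move=> m].
  move: y; apply: malg_linear_ext; [exact: lr | exact/lin0/ll | move=> n].
  by rewrite !brE (addrC n) canti scaleNr.
split; first by split.
  move=> x; apply/malgP => k; have /eqP := congr1 (mcoeff k) (anti x x).
  by rewrite mcoeffN mcoeff0 -addr_eq0 -mulr2n mulrn_eq0 => /eqP.
move=> x y z; move: x; apply: malg_linear_ext;
  [exact: (linD _ _ (linD _ _ (ll _) (linC _ _ (lr y) (lr z)))
                    (linC _ _ (lr z) (ll y))) | exact: linZ0 | move=> m].
move: y; apply: malg_linear_ext;
  [exact: (linD _ _ (linD _ _ (linC _ _ (lr _) (ll z)) (ll _))
                    (linC _ _ (lr z) (lr _))) | exact: linZ0 | move=> n].
move: z; apply: malg_linear_ext;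
  [exact: (linD _ _ (linD _ _ (linC _ _ (lr _) (lr _))
                              (linC _ _ (lr _) (ll _))) (ll _))
  | exact: linZ0 | ].
move=> k; rewrite !brE !brZr !brE !scalerA.
have -> : n + (k + m) = m + (n + k) by rewrite addrA addrC.
have -> : k + (m + n) = m + (n + k) by rewrite addrC addrA.
by rewrite -!scalerDl cjac scale0r.
Qed.

Section LieAlgebra.
Context {R : realType} {d : nat}.

Local Notation C := R[i].
Local Notation Zd := 'rV[int]_d.

Definition generic (gamma : 'rV[C]_d) : Prop :=
  forall c : 'I_d -> rat,
    \sum_i ratr (c i) * gamma 0 i = 0 -> forall i, c i = 0.

Definition sigma (Q : 'M[C]_d) (m n : Zd) : C :=
  \prod_(i < d) \prod_(j < d | (i < j)%N) Q j i ^ (m 0 j * n 0 i).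

Definition radical (Q : 'M[C]_d) : set Zd :=
  [set m | forall n, sigma Q m n = sigma Q n m].

Definition pairing (gamma : 'rV[C]_d) (n : Zd) : C :=
  \sum_i gamma 0 i * (n 0 i)%:~R.

(* The underlying space of g(gamma, Q), with basis L m, m in Z^d. *)
Local Notation gspace := {malg C[Zd]}.

Definition L (m : Zd) : gspace := << m >>.

(* [L m, L n] = bracket_coef m n *: L (m + n); the case m \notin radical,
   n \in radical is forced by antisymmetry. *)
Definition bracket_coef (gamma : 'rV[C]_d) (Q : 'M[C]_d) (m n : Zd) : C :=
  if m \in radical Q then
    if n \in radical Q then sigma Q m n * pairing gamma (n - m)
    else sigma Q m n * pairing gamma n
  else
    if n \in radical Q then - (sigma Q n m * pairing gamma m)
    else sigma Q m n - sigma Q n m.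

Definition bracket (gamma : 'rV[C]_d) (Q : 'M[C]_d) (x y : gspace) : gspace :=
  malg_linear
    (fun m => malg_linear (fun n => bracket_coef gamma Q m n *: L (m + n)) y) x.

Lemma bracket_L gamma Q (m n : Zd) :
  bracket gamma Q (L m) (L n) = bracket_coef gamma Q m n *: L (m + n).
Proof. by rewrite /bracket /L !malg_linearU. Qed.

Section BracketIsLie.
Variables (gamma : 'rV[C]_d) (Q : 'M[C]_d).
Hypothesis Qinv : forall i j, Q i j * Q j i = 1.

Local Notation s := (sigma Q).
Local Notation p := (pairing gamma).
Local Notation r := (radical Q).
Local Notation c := (bracket_coef gamma Q).
Local Notation br := (bracket gamma Q).

Local Lemma Qneq0 i j : Q i j != 0.
Proof.
by apply/eqP => q0; have /esym/eqP := Qinv i j; rewrite q0 mul0r oner_eq0.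
Qed.

Local Lemma sigmaDl m n k : s (m + n) k = s m k * s n k.
Proof.
rewrite /sigma -big_split; apply: eq_bigr => i _.
rewrite -big_split; apply: eq_bigr => j _.
by rewrite mxE mulrDl expfzDr ?Qneq0.
Qed.

Local Lemma sigmaDr m n k : s m (n + k) = s m n * s m k.
Proof.
rewrite /sigma -big_split; apply: eq_bigr => i _.
rewrite -big_split; apply: eq_bigr => j _.
by rewrite mxE mulrDr expfzDr ?Qneq0.
Qed.

Local Lemma sigma_neq0 m n : s m n != 0.
Proof.
apply/prodf_neq0 => i _; apply/prodf_neq0 => j _.
by rewrite expfz_neq0 ?Qneq0.
Qed.

Local Lemma pairingD m n : p (m + n) = p m + p n.
Proof.
rewrite /pairing -big_split; apply: eq_bigr => i _.
by rewrite mxE rmorphD mulrDr.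
Qed.

Local Lemma pairingN m : p (- m) = - p m.
Proof.
rewrite /pairing -sumrN; apply: eq_bigr => i _.
by rewrite mxE rmorphN mulrN.
Qed.

Local Lemma radicalP m : reflect (forall n, s m n = s n m) (m \in r).
Proof. by apply: (iffP idP); rewrite inE. Qed.

Local Lemma radicalDl m n : m \in r -> (m + n \in r) = (n \in r).
Proof.
move=> /radicalP mr; apply/radicalP/radicalP => nr k; last first.
  by rewrite sigmaDl sigmaDr mr nr.
apply: (mulfI (sigma_neq0 m k)); rewrite -sigmaDl nr sigmaDr.
by rewrite -mr.
Qed.

Local Lemma radicalDr m n : m \in r -> (n + m \in r) = (n \in r).
Proof. by rewrite addrC; exact: radicalDl. Qed.

Local Lemma radicalD_comm m n : m + n \in r -> s m n = s n m.
Proof.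
move=> /radicalP /(_ n); rewrite sigmaDl sigmaDr.
by move/(mulIf (sigma_neq0 _ _)).
Qed.

Local Lemma coef_anti m n : c m n = - c n m.
Proof.
rewrite /bracket_coef; case: ifPn => [/radicalP mr|_]; case: ifPn => nr //.
- by rewrite mr !pairingD !pairingN; ring.
- by rewrite opprK.
- by rewrite opprB.
Qed.

Local Lemma coef_jacobi m n k :
  c n k * c m (n + k) + c k m * c n (k + m) + c m n * c k (m + n) = 0.
Proof.
have cNN a b e : a \notin r -> b \notin r ->
    c a b * c e (a + b) = (s a b - s b a) *
      (if e \in r then s e (a + b) * p (a + b)
       else s e (a + b) - s (a + b) e).
  move=> /negPf ar /negPf br; rewrite {1}/bracket_coef ar br.
  have [/radicalD_comm -> | abr] := boolP (a + b \in r).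
    by rewrite subrr !mul0r.
  by rewrite /bracket_coef (negPf abr).
have RRN a b e : a \in r -> b \in r -> e \notin r ->
    c b e * c a (b + e) + c e a * c b (e + a) + c a b * c e (a + b) = 0.
  move=> ar br /negPf er; rewrite /bracket_coef.
  rewrite !(radicalDl _ ar, radicalDl _ br, radicalDr _ ar).
  rewrite ar br er.
  rewrite !(sigmaDl, sigmaDr, pairingD, pairingN) (radicalP _ ar b).
  by ring.
have RNN a b e : a \in r -> b \notin r -> e \notin r ->
    c b e * c a (b + e) + c e a * c b (e + a) + c a b * c e (a + b) = 0.
  move=> ar br er; rewrite cNN // /bracket_coef.
  rewrite !(radicalDl _ ar, radicalDr _ ar).
  rewrite ar (negPf br) (negPf er).
  rewrite !(sigmaDl, sigmaDr, pairingD, pairingN).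
  by rewrite !(radicalP _ ar); ring.
have [mr|mr] := boolP (m \in r); have [nr|nr] := boolP (n \in r);
  have [kr|kr] := boolP (k \in r).
- rewrite /bracket_coef !(radicalDr, radicalDl) // mr nr kr.
  rewrite !(sigmaDl, sigmaDr, pairingD, pairingN).
  by rewrite (radicalP _ mr n) (radicalP _ nr k) (radicalP _ kr m); ring.
- exact: RRN.
- by rewrite addrC addrA; exact: RRN.
- exact: RNN.
- by rewrite -addrA addrC; exact: RRN.
- by rewrite -addrA addrC; exact: RNN.
- by rewrite addrC addrA; exact: RNN.
- rewrite !cNN // (negPf mr) (negPf nr) (negPf kr) !(sigmaDl, sigmaDr).
  by ring.
Qed.

Lemma bracket_bilinear : bilinear_bracket br.
Proof.
split=> [x|y].
  move=> a y z; apply: (etrans _ (malg_linear_fun a _ _ x)).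
  congr (malg_linear _ x).
  by apply/funext => k; exact: malg_linear_linear.
exact: malg_linear_linear.
Qed.

Lemma bracket_lie : is_lie_bracket br.
Proof.
apply: (basis_lie_bracket bracket_bilinear (c := c)).
- exact: bracket_L.
- exact: coef_anti.
- exact: coef_jacobi.
Qed.

End BracketIsLie.

Definition ad gamma Q (x : gspace) : gspace -> gspace := bracket gamma Q x.

Definition partial (i : 'I_d) (x : gspace) : gspace :=
  malg_linear (fun m : Zd => (m 0 i)%:~R *: L m) x.

Definition Der gamma Q : set (gspace -> gspace) := derivation (bracket gamma Q).

Definition Der_deg gamma Q (n : Zd) : set (gspace -> gspace) :=
  Der gamma Q `&` [set D | forall m, exists c : C, D (L m) = c *: L (m + n)].

End LieAlgebra.

(* Main.v *)
Require Import Defs.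
From mathcomp Require Import all_boot all_order all_algebra finmap.
From mathcomp Require Import boolp classical_sets functions reals.
From mathcomp Require Import complex monalg.

Import GRing.Theory Num.Theory.
Local Open Scope classical_set_scope.
Local Open Scope ring_scope.

(** The element L_0 does most of the work: [L_0, L_m] = (gamma | m) L_m, and by
genericity the numbers (gamma | m) are pairwise distinct, so ad L_0 is
diagonal in the basis L with simple spectrum. Applying a derivation D to
[L_0, L_m] = (gamma | m) L_m and comparing coefficients of L_k gives

  ((gamma | m) - (gamma | k)) * (D L_m)_k = ([D L_0, L_m])_k

[mcoeff_derivation], so that D is determined off the diagonal by D L_0.

If D L_0 is a multiple of L_0 the right-hand side vanishes for k <> m, and D
has degree 0 [degree0_of_eigenvector]. An arbitrary D is brought to this case
by adding finitely many multiples of ad L_n, n <> 0, which cancel the other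
coefficients of D L_0 [derivation_decomposition]; in particular a derivation is
a finite sum of homogeneous ones without any appeal to finite generation. If D
has degree n <> 0, the same formula at k = m + n shows directly that D is a
multiple of ad L_n [degree_neq0_inner]. None of this uses more than a
Lie bracket graded by an abelian group with such an L_0.

In degree 0, D L_m = f(m) L_m, and D is a derivation exactly when
f(m + n) = f(m) + f(n) for all m, n with [L_m, L_n] <> 0. The task is to see
that f is then additive everywhere [coef_additive]; an additive function on
Z^d is a combination of the coordinates, so D is a combination of the
partial_i. Among pairs with an element in R this only fails to be immediate
when m = n, where f(m) = f(2m) + f(-m) and f(m) + f(-m) = 0 help.
For m, n outside R, additivity is known when beta(m, n) <> 1, where
beta(m, n) = sigma(m, n) / sigma(n, m) is an alternating bicharacter with
radical R. Let beta(m, n) = 1. If m + n is in R, write n = (m + n) - m.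
Otherwise one looks for t not commuting with any of m, n, m + n, and expands
f(m + n + t) in two ways. Such a t can only be missing if three proper
subgroups cover Z^d; then all three have index 2 and the characters
beta(m, .) and beta(n, .) take values in {1, -1} [three_characters], so
2m and 2n lie in R, where additivity is known, and
2 f(m + n) = 2 f(m) + 2 f(n) [partially_additive]. *)

(** * Three characters of an abelian group *)

Section Characters.
Context {G : zmodType} {K : idomainType}.
Implicit Types (chi psi : G -> K) (a b t : G).

(** A group is not the union of two proper subgroups. *)
Lemma common_nontrivial {chi psi} :
  {morph chi : a b / a + b >-> a * b} -> {morph psi : a b / a + b >-> a * b} ->
  (exists a, chi a <> 1) -> (exists b, psi b <> 1) ->
  exists t, chi t <> 1 /\ psi t <> 1.
Proof.
move=> chiM psiM [a chia] [b psib].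
have [psia|] := pselect (psi a = 1); last by exists a.
have [chib|] := pselect (chi b = 1); last by exists b.
by exists (a + b); rewrite chiM psiM chib psia mulr1 mul1r.
Qed.

Section NoCommonNontrivial.
Context {chi psi}.
Hypothesis chiM : {morph chi : a b / a + b >-> a * b}.
Hypothesis psiM : {morph psi : a b / a + b >-> a * b}.
Hypothesis cover : forall t, [\/ chi t = 1, psi t = 1 | chi t * psi t = 1].

(** If the kernels of chi, psi and chi * psi cover the group, then a lies only
in the third kernel and b only in the second. Hence a + b and a - b avoid the
last two and lie in the first: chi a = chi b = (chi b)^-1. *)
Lemma cover_sign a b :
  chi a <> 1 -> psi a <> 1 -> chi b <> 1 -> psi b = 1 ->
  chi a ^+ 2 = 1 /\ chi b ^+ 2 = 1.
Proof.
move=> chia psia chib psib.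
have chipsia : chi a * psi a = 1 by case: (cover a).
have chiab : chi a * chi b = 1.
  rewrite -chiM; case: (cover (a + b)) => //; first by rewrite psiM psib mulr1.
  by rewrite chiM psiM psib mulr1 mulrAC chipsia mul1r.
have chiBE : chi (a - b) * chi b = chi a by rewrite -chiM subrK.
have psiBE : psi (a - b) = psi a by rewrite -[LHS]mulr1 -psib -psiM subrK.
have chi_eq : chi a = chi b.
  rewrite -chiBE; case: (cover (a - b)) => [->|psi1|chipsi1].
  - exact: mul1r.
  - by case: psia; rewrite -psiBE.
  case: chib; rewrite -[RHS]chipsia -chiBE -psiBE.
  by rewrite mulrAC chipsi1 mul1r.
by split; rewrite expr2; [rewrite {2}chi_eq | rewrite -{1}chi_eq].
Qed.

(** Every element outside the kernel of chi is of one of the two kinds compared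
in [cover_sign], so it can be paired with a fixed element of the other kind. *)
Lemma cover_sqr1 a b :
  chi a <> 1 -> psi a <> 1 -> chi b <> 1 -> psi b = 1 ->
  forall t, chi t ^+ 2 = 1.
Proof.
move=> chia psia chib psib t.
have [->|chit] := pselect (chi t = 1); first exact: expr1n.
have [psit|psit] := pselect (psi t = 1).
  by have [] := cover_sign a t chia psia chit psit.
by have [] := cover_sign t b chit psit chib psib.
Qed.
End NoCommonNontrivial.

(** A form of Scorza's theorem: three proper subgroups that cover a group have
index 2. Here the third subgroup is the kernel of the product. *)
Lemma three_characters {chi psi} :
  {morph chi : a b / a + b >-> a * b} -> {morph psi : a b / a + b >-> a * b} ->
  (exists a, chi a <> 1) -> (exists a, psi a <> 1) ->
  (exists a, chi a * psi a <> 1) ->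
  (exists t, [/\ chi t <> 1, psi t <> 1 & chi t * psi t <> 1]) \/
  (forall t, chi t ^+ 2 = 1 /\ psi t ^+ 2 = 1).
Proof.
move=> chiM psiM nchi npsi nchipsi.
have [|none] := pselect (exists t,
  [/\ chi t <> 1, psi t <> 1 & chi t * psi t <> 1]).
  by left.
right=> t.
have cover u : [\/ chi u = 1, psi u = 1 | chi u * psi u = 1].
  have [|h1] := pselect (chi u = 1); first by constructor 1.
  have [|h2] := pselect (psi u = 1); first by constructor 2.
  have [|h3] := pselect (chi u * psi u = 1); first by constructor 3.
  by case: none; exists u.
have chipsiM : {morph (fun u => chi u * psi u) : a b / a + b >-> a * b}.
  by move=> a b; rewrite chiM psiM mulrACA.
have [a [chia psia]] := common_nontrivial chiM psiM nchi npsi.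
have [b [chib chipsib]] := common_nontrivial chiM chipsiM nchi nchipsi.
have [c [psic chipsic]] := common_nontrivial psiM chipsiM npsi nchipsi.
split.
  by apply: (cover_sqr1 chiM psiM cover a b) => //; case: (cover b).
apply: (cover_sqr1 psiM chiM _ a c) => //; last by case: (cover c).
move=> u; rewrite mulrC.
by case: (cover u); [constructor 2|constructor 1|constructor 3].
Qed.

End Characters.

(** * Functions additive on non-commuting pairs *)

Section PartiallyAdditive.
Context {G : zmodType} {K : idomainType} {F : numDomainType}.
Variables (beta : G -> G -> K) (f : G -> F).
Hypothesis betaDl : forall t, {morph beta^~ t : a b / a + b >-> a * b}.
Hypothesis betaDr : forall t, {morph beta t : a b / a + b >-> a * b}.
Hypothesis beta_diag : forall a, beta a a = 1.
Hypothesis f_noncomm : forall a b, beta a b <> 1 -> f (a + b) = f a + f b.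
Hypothesis f_radical : forall a b,
  (forall t, beta a t = 1) -> f (a + b) = f a + f b.

(** Outside the radical, pick t with beta a t <> 1. Then also
beta (- a) (a + t) <> 1, and f t = f (- a + (a + t)) can be expanded. *)
Lemma partially_additive_opp a : f (- a) = - f a.
Proof.
have b0l t : beta 0 t = 1.
  by rewrite -[LHS]mulr1 -(beta_diag t) -betaDl add0r.
have f0 : f 0 = 0.
  by have /eqP := f_radical 0 0 b0l; rewrite addr0 -subr_eq subrr => /eqP.
apply/eqP; rewrite -addr_eq0.
have [ar|] := pselect (forall t, beta a t = 1).
  by rewrite addrC -f_radical // subrr f0.
move=> /existsNP [t bat].
have E : f (- a + (a + t)) = f (- a) + f (a + t).
  apply: f_noncomm => bNa; apply: bat.
  have bNaa : beta (- a) a = 1.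
    by rewrite -[LHS]mulr1 -(beta_diag a) -betaDl addNr b0l.
  have bNat : beta (- a) t = 1 by rewrite -[LHS]mul1r -{1}bNaa -betaDr.
  by rewrite -[LHS]mul1r -{1}bNat -betaDl addNr b0l.
by move: E; rewrite addKr f_noncomm // addrA -{1}[f t]add0r => /addIr <-.
Qed.

(** Let beta r s = 1, with r, s and r + s outside the radical. If some t
commutes with none of r, s and r + s, then f (r + s + t) expands in two ways.
Otherwise r + r and s + s are in the radical, and f is compared on doubles. *)
Lemma partially_additive : {morph f : a b / a + b}.
Proof.
move=> r s.
have [|] := pselect (beta r s = 1); last exact: f_noncomm.
move=> brs.
have [|rr] := pselect (forall t, beta r t = 1); first exact: f_radical.
have [rsr|rsr] := pselect (forall t, beta (r + s) t = 1).
  have := f_radical _ (- r) rsr; rewrite addrAC subrr add0r.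
  by rewrite partially_additive_opp => ->; rewrite addrCA subrr addr0.
have [sr|sr] := pselect (forall t, beta s t = 1).
  by rewrite addrC f_radical // addrC.
have nrs : exists a, beta r a * beta s a <> 1.
  by have /existsNP[t] := rsr; rewrite betaDl; exists t.
have [[t [rt st rst]]|sq] := three_characters (betaDr r) (betaDr s)
  ((existsNP _).2 rr) ((existsNP _).2 sr) nrs.
  (* beta r (s + t) = beta r t, because beta r s = 1 *)
  apply: (@addIr _ (f t)); rewrite /= -[LHS]f_noncomm ?betaDl // -[in LHS]addrA.
  rewrite [LHS]f_noncomm ?betaDr ?brs ?mul1r //.
  by rewrite (f_noncomm _ _ st) addrA.
(* f u = f ((u + u) - u), where u + u is in the radical *)
have double u : (forall t, beta u t ^+ 2 = 1) ->
    (forall t, beta (u + u) t = 1) /\ f (u + u) = f u *+ 2.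
  move=> u2; have uur t : beta (u + u) t = 1 by rewrite betaDl -expr2.
  split=> //; have := f_radical _ (- u) uur.
  rewrite addrK partially_additive_opp => /eqP.
  by rewrite eq_sym subr_eq => /eqP.
have [rr2 fr2] := double r (fun t => (sq t).1).
have [_ fs2] := double s (fun t => (sq t).2).
have [|_ frs2] := double (r + s).
  move=> t; rewrite betaDl exprMn.
  by have [-> ->] := sq t; rewrite mulr1.
apply: (@pmulrnI F 2 isT).
by rewrite /= -frs2 addrACA f_radical // fr2 fs2 mulrnDl.
Qed.

End PartiallyAdditive.

(** * Subspaces, spans and derivations *)

Section Subspaces.
Context {F : fieldType} {V : lmodType F}.
Implicit Types (A W : set V).

Lemma is_subspaceP W :
  is_subspace W <-> W 0 /\ forall a u v, W u -> W v -> W (a *: u + v).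
Proof.
split=> [[W0 Wlin]|[W0 Wlin]]; split.
- by move: W0; rewrite inE.
- move=> a u v Wu Wv; suff : a *: u + v \in [in W] by rewrite inE.
  by apply: Wlin; rewrite inE.
- by rewrite inE.
- by move=> a u v; rewrite !inE; apply: Wlin.
Qed.

Lemma lspan_sub A W : is_subspace W -> A `<=` W -> lspan A `<=` W.
Proof.
move=> /is_subspaceP[W0 Wlin] AW v [s [c [sA ->]]].
elim: s sA => [|u s IH] sA; first by rewrite big_nil.
rewrite big_cons; apply: Wlin; first by apply/AW/sA; rewrite mem_head.
by apply: IH => w ws; apply: sA; rewrite in_cons ws orbT.
Qed.

Lemma lspan_sum (I : finType) (g : I -> V) (a : I -> F) :
  lspan (range g) (\sum_i a i *: g i).
Proof.
(* g may take a value several times: its coefficients are then added up *)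
exists (undup (codom g)), (fun u => \sum_(i | g i == u) a i); split.
  by move=> u; rewrite mem_undup => /codomP[i ->]; exists i.
under [RHS]eq_bigr do rewrite scaler_suml.
rewrite [RHS](exchange_big_dep predT) //=; apply: eq_bigr => i _.
under [RHS]eq_bigl do rewrite eq_sym.
rewrite -big_filter filter_pred1_uniq ?undup_uniq ?big_seq1 //.
by rewrite mem_undup codom_f.
Qed.

End Subspaces.

Section LieDerivations.
Context {F : fieldType} {V : lmodType F}.

Lemma linearD {f g : V -> V} :
  linear f -> linear g -> linear (fun x => f x + g x).
Proof. by move=> lf lg a x y; rewrite lf lg scalerDr addrACA. Qed.

Lemma linear_compose {f g : V -> V} :
  linear f -> linear g -> linear (fun x => f (g x)).
Proof. by move=> lf lg a x y; rewrite lg lf. Qed.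

Lemma linear_add {f : V -> V} : linear f -> {morph f : x y / x + y}.
Proof. by move=> lf x y; have := lf 1 x y; rewrite !scale1r. Qed.

Lemma lie_antisymmetric (br : V -> V -> V) : is_lie_bracket br ->
  forall x y, br x y = - br y x.
Proof.
move=> [[lr ll] alt _] x y; apply/eqP; rewrite -addr_eq0.
have := alt (x + y); rewrite (linear_add (lr _)) !(linear_add (ll _)).
by rewrite !alt add0r addr0 addrC => ->.
Qed.

Lemma lie_ad_derivation (br : V -> V -> V) (x : V) :
  is_lie_bracket br -> derivation br (br x).
Proof.
move=> lie; have anti := lie_antisymmetric _ lie.
have [[lr ll] _ jac] := lie; split=> // y z.
have opp w u : br w (- u) = - br w u.
  by rewrite -scaleN1r (linear_scale (lr w)) scaleN1r.
have := jac x y z; rewrite (anti z x) opp (anti z (br x y)).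
by move/eqP; rewrite subr_eq add0r subr_eq addrC => /eqP.
Qed.

Lemma derivation_subspace (br : V -> V -> V) :
  bilinear_bracket br -> is_subspace (derivation br).
Proof.
move=> [lr ll]; apply/is_subspaceP; split.
  have br0 : forall x, br x 0 = 0.
    by move=> x; have := linear_scale (lr x) 0 0; rewrite !scale0r.
  have b0r : forall x, br 0 x = 0.
    by move=> x; have := linear_scale (ll x) 0 0; rewrite !scale0r.
  split=> [a x y|x y]; first by rewrite -[RHS]/(a *: 0 + 0) scaler0 addr0.
  by rewrite -[RHS]/(br 0 y + br x 0) br0 b0r addr0.
move=> a D E [lD dD] [lE dE]; split=> [b x y|x y]; rewrite !fctE.
  by rewrite lD lE !scalerDr !scalerA mulrC addrACA.
by rewrite dD dE lr ll scalerDr addrACA.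
Qed.

End LieDerivations.

(** * Coefficients in a basis *)

Section MonoidAlgebra.
Context {F : fieldType} {K : choiceType}.
Implicit Types (x : {malg F[K]}).

Lemma malg_basis_sum x (E : {fset K}) : fsubset (msupp x) E ->
  x = \sum_(k <- E) x@_k *: << k >>.
Proof.
move=> /malg_linearEw <-; apply: malg_linear_ext x => //.
  exact: malg_linear_linear.
by move=> k; rewrite malg_linearU.
Qed.

Lemma mcoeff_malg_diag (a : K -> F) x k :
  (malg_linear (fun j => a j *: << j >>) x)@_k = a k * x@_k.
Proof.
rewrite (@malg_linearEw _ _ _ _ x (k |` msupp x)%fset) ?fsubsetU1 //.
rewrite (big_fsetD1 k) ?fset1U1 //= mcoeffD !mcoeffZ mcoeffUU mulr1 mulrC.
rewrite raddf_sum big_seq big1 ?addr0 // => j; rewrite in_fsetD1 => /andP[jk _].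
by rewrite /= !mcoeffZ mcoeffU (negPf jk) !mulr0.
Qed.

Lemma derivation_basis (br : {malg F[K]} -> {malg F[K]} -> {malg F[K]}) D :
  bilinear_bracket br -> linear D ->
  (forall j k, D (br << j >> << k >>) =
     br (D << j >>) << k >> + br << j >> (D << k >>)) ->
  derivation br D.
Proof.
move=> [lr ll] lD Dbasis; split=> // x y.
move: x; apply: malg_linear_ext.
- exact: linear_compose lD (ll y).
- exact: linearD (linear_compose (ll y) lD) (ll (D y)).
move=> j; move: y; apply: malg_linear_ext => //.
- exact: linear_compose lD (lr _).
- exact: linearD (lr _) (linear_compose (lr _) lD).
Qed.

End MonoidAlgebra.

Lemma additive_coordinates {n : nat} {V : zmodType} {f : 'rV[int]_n -> V} :
  {morph f : a b / a + b} -> forall m, f m = \sum_i f 'e_i *~ m 0 i.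
Proof.
move=> fD m.
have f0 : f 0 = 0 by apply: (@addIr _ (f 0)); rewrite -fD !add0r.
have fN a : f (- a) = - f a by apply/eqP; rewrite -addr_eq0 -fD addNr f0.
have fMn a k : f (a *+ k) = f a *+ k.
  by elim: k => [|k IH]; rewrite ?mulr0n // !mulrS fD IH.
have fMz a k : f (a *~ k) = f a *~ k.
  by case: k => k; rewrite ?NegzE ?mulrNz ?fN -!pmulrn fMn.
rewrite {1}[m]row_sum_delta (big_morph f fD f0); apply: eq_bigr => i _.
by rewrite -fMz -scaler_int intz.
Qed.

(** * Derivations of a graded Lie algebra in which ad L_0 has simple spectrum *)

Section GradedLieAlgebra.
Context {F : fieldType} {G : zmodType}.

(** Stated for any Lie bracket on a space with basis indexed by an abelian group
G, so that [Der_deg] is the instance F = C, G = Z^d. *)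
Definition derivation_of_degree
    (br : {malg F[G]} -> {malg F[G]} -> {malg F[G]}) n :=
  derivation br `&`
  [set D | forall m, exists a : F, D << m >> = a *: << m + n >>].

Definition diagonal (phi : G -> F) : {malg F[G]} -> {malg F[G]} :=
  malg_linear (fun m => phi m *: << m >>).

Context {br : {malg F[G]} -> {malg F[G]} -> {malg F[G]}} {c : G -> G -> F}.
Hypothesis br_lie : is_lie_bracket br.
Hypothesis br_basis : forall m n, br << m >> << n >> = c m n *: << m + n >>.

Local Notation gspace := {malg F[G]}.
Implicit Types (m n k : G) (x : gspace) (D : gspace -> gspace).

Let br_bilinear : bilinear_bracket br.
Proof. by have [] := br_lie. Qed.
Let lr : forall x, linear (br x) := br_bilinear.1.
Let ll : forall y, linear (br^~ y) := br_bilinear.2.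

Lemma linear_basis_ext D1 D2 : linear D1 -> linear D2 ->
  (forall m, D1 << m >> = D2 << m >>) -> D1 = D2.
Proof. by move=> l1 l2 eqb; apply/funext/malg_linear_ext. Qed.

Lemma ad_basis_degree n : derivation_of_degree br n (br << n >>).
Proof.
split; first exact: lie_ad_derivation.
by move=> m; exists (c n m); rewrite br_basis addrC.
Qed.

Lemma diagonal_degree0 phi : {morph phi : m n / m + n} ->
  derivation_of_degree br 0 (diagonal phi).
Proof.
move=> phiD; have lphi : linear (diagonal phi) by exact: malg_linear_linear.
have phiE m : diagonal phi << m >> = phi m *: << m >> by exact: malg_linearU.
split; last by move=> m; exists (phi m); rewrite phiE addr0.
apply: derivation_basis => // m n.
rewrite !phiE (linear_scale (lr _)) (linear_scale (ll _)) br_basis.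
rewrite (linear_scale lphi) phiE !scalerA -scalerDl phiD mulrDr.
by rewrite !(mulrC (c m n)).
Qed.

Lemma derivation_of_degree_subspace n : is_subspace (derivation_of_degree br n).
Proof.
have /is_subspaceP[D0 Dlin] := derivation_subspace _ br_bilinear.
apply/is_subspaceP; split.
  by split=> // m; exists 0; rewrite scale0r.
move=> a D E [dD degD] [dE degE]; split; first exact: Dlin.
move=> m; have [b Db] := degD m; have [e Ee] := degE m; exists (a * b + e).
by rewrite !fctE Db Ee scalerDl scalerA.
Qed.

(** The images of one basis vector under derivations of different degrees are
multiples of different basis vectors. *)
Lemma derivations_of_degree_independent (S : {fset G})
    (b : G -> gspace -> gspace) :
  (forall n, derivation_of_degree br n (b n)) ->
  \sum_(n <- S) b n = 0 -> forall n, n \in S -> b n = 0.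
Proof.
move=> degb sum0 n nS; have [[lb _] degbn] := degb n.
apply: linear_basis_ext => // [a x y|m].
  by rewrite -[RHS]/(a *: 0 + 0) scaler0 addr0.
have := congr1 (fun D => (D << m >>)@_(m + n)) sum0.
rewrite (big_fsetD1 n) //= fctE fct_sumE mcoeffD raddf_sum.
rewrite big_seq big1 ?addr0.
  have [a ->] := degbn m; rewrite mcoeffZ mcoeffUU mulr1 mcoeff0 => ->.
  by rewrite scale0r.
move=> k; rewrite in_fsetD1 => /andP[kn _]; have [_ /(_ m)[a ->]] := degb k.
by rewrite /= mcoeffZ mcoeffU (inj_eq (addrI m)) (negPf kn) mulr0.
Qed.

Section EigenvaluesOfL0.
Context {p : G -> F}.
Hypothesis pD : {morph p : m n / m + n}.
Hypothesis p_inj : injective p.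
Hypothesis c0 : forall n, c 0 n = p n.

Let p_neq0 n : n != 0 -> p n != 0.
Proof.
apply: contra_neq => pn0; apply: p_inj; apply: (@addIr _ (p n)).
by rewrite /= -[RHS]pD add0r pn0 addr0.
Qed.

Lemma mcoeff_ad0 x k : (br << 0 >> x)@_k = p k * x@_k.
Proof.
rewrite -mcoeff_malg_diag; congr (_@_k).
apply: malg_linear_ext x => [||n]; first exact: lr.
  exact: malg_linear_linear.
by rewrite br_basis malg_linearU add0r c0.
Qed.

(** Coefficient of << k >> in D [<< 0 >>, << m >>] = D (p m *: << m >>). Since p
is injective, D << 0 >> determines every off-diagonal coefficient of D. *)
Lemma mcoeff_derivation D m k : derivation br D ->
  (p m - p k) * (D << m >>)@_k = (br (D << 0 >>) << m >>)@_k.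
Proof.
move=> [lD dD]; have := congr1 (mcoeff k) (dD << 0 >> << m >>).
rewrite br_basis c0 add0r (linear_scale lD) mcoeffZ mcoeffD.
by rewrite [X in _ + X]mcoeff_ad0 mulrBl => ->; rewrite addrK.
Qed.

(** By [mcoeff_derivation]: [<< 0 >>, << m >>] has no coefficient at k <> m. *)
Lemma degree0_of_eigenvector D a :
  derivation br D -> D << 0 >> = a *: << 0 >> -> derivation_of_degree br 0 D.
Proof.
move=> dD DL0; split=> // m; exists (D << m >>)@_m; rewrite addr0.
apply/malgP => k; rewrite mcoeffZ mcoeffU.
have [->|mk] := eqVneq m k; first by rewrite mulr1.
have := mcoeff_derivation D m k dD; rewrite DL0 (linear_scale (ll _)) mcoeffZ.
rewrite mcoeff_ad0 mcoeffU (negPf mk) !mulr0 => /eqP.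
by rewrite mulf_eq0 subr_eq0 (inj_eq p_inj) (negPf mk) => /eqP.
Qed.

(** If D << 0 >> = a << n >>, then [mcoeff_derivation] at k = m + n reads
- p n * (D << m >>)_(m + n) = a * c n m, that is, D = - (a / p n) ad << n >>. *)
Lemma degree_neq0_inner n D : n != 0 -> derivation_of_degree br n D ->
  exists a, D = a *: br << n >>.
Proof.
move=> n0 [dD degD]; have [a DL0] := degD 0; exists (- (a / p n)).
apply: linear_basis_ext => [|b x y|m]; first exact: dD.1.
  by rewrite !fctE lr scalerDr !scalerA mulrC.
rewrite !fctE br_basis scalerA (addrC n); have [b DLm] := degD m.
have := mcoeff_derivation D m (m + n) dD.
rewrite DL0 DLm add0r (linear_scale (ll _)) br_basis !mcoeffZ (addrC n).
rewrite !mcoeffUU !mulr1.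
rewrite pD opprD addrA subrr add0r => E.
by rewrite mulNr mulrAC -E mulNr mulNr opprK mulrAC mulfV ?mul1r ?p_neq0.
Qed.

(** As [<< n >>, << 0 >>] = - p n *: << n >>, adding x_n / p n times ad << n >>
to D removes the coefficient x_n of << n >> in x = D << 0 >>. *)
Lemma derivation_decomposition D : derivation br D ->
  exists a : G -> F, exists E : {fset G}, 0 \notin E /\
    derivation_of_degree br 0 (D - \sum_(n <- E) a n *: br << n >>).
Proof.
move=> dD; pose x := D << 0 >>; pose S := (0 |` msupp x)%fset.
have cr0 n : c n 0 = - p n.
  have := lie_antisymmetric _ br_lie << n >> << 0 >>.
  rewrite !br_basis addr0 add0r c0 => /(congr1 (mcoeff n)).
  by rewrite mcoeffN !mcoeffZ mcoeffUU !mulr1.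
exists (fun n => - (x@_n / p n)), (S `\ 0)%fset; split.
  by rewrite in_fsetD1 eqxx.
have /is_subspaceP[D0 Dlin] := derivation_subspace _ br_bilinear.
apply: (degree0_of_eigenvector _ x@_0).
  rewrite addrC -scaleN1r; apply: (Dlin) => //.
  elim/big_rec: _ => // n E _ dE; apply: (Dlin) => //.
  by have [] := ad_basis_degree n.
rewrite !fctE fct_sumE -/x {1}(malg_basis_sum x S) ?fsubsetU1 //.
rewrite (big_fsetD1 0) ?fset1U1 //= -addrA -sumrB big_seq big1 ?addr0 //.
move=> n; rewrite in_fsetD1 => /andP[n0 _].
by rewrite !fctE br_basis cr0 addr0 scalerA mulrNN divfK ?subrr ?p_neq0.
Qed.

Lemma derivation_direct_sum :
  is_direct_sum (derivation br) (derivation_of_degree br).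
Proof.
have dsub := derivation_subspace _ br_bilinear.
split=> //.
- exact: derivation_of_degree_subspace.
- apply/seteqP; split=> D /=; last first.
    move=> [S [b [degb ->]]]; have [D0 Dlin] := (is_subspaceP _).1 dsub.
    elim/big_rec: _ => // n E _ dE; rewrite -[b n]scale1r; apply: (Dlin) => //.
    by have [] := degb n.
  move=> dD; have [a [E [E0 degE]]] := derivation_decomposition D dD.
  exists (0 |` E)%fset, (fun n => if n == 0
    then D - \sum_(k <- E) a k *: br << k >> else a n *: br << n >>).
  split.
    move=> n; case: eqVneq => [->//|_].
    have /is_subspaceP[D0 Dlin] := derivation_of_degree_subspace n.
    by rewrite -[_ *: _]addr0; apply: (Dlin) => //; exact: ad_basis_degree.
  rewrite big_fsetU1 //= eqxx.
  rewrite [X in _ + X](_ : _ = \sum_(k <- E) a k *: br << k >>).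
    by rewrite subrK.
  rewrite big_seq [RHS]big_seq; apply: eq_bigr => k kE.
  by rewrite ifN //; apply: contraNneq E0 => <-.
- exact: derivations_of_degree_independent.
Qed.

Lemma degree_neq0_span n : n != 0 ->
  derivation_of_degree br n = lspan [set br << n >>].
Proof.
move=> n0; apply/seteqP; split.
  move=> D /(degree_neq0_inner n D n0)[a ->].
  exists [:: br << n >>], (fun=> a); rewrite big_seq1; split=> // u.
  by rewrite inE => /eqP.
apply: lspan_sub (derivation_of_degree_subspace n) _ => _ ->.
exact: ad_basis_degree.
Qed.

End EigenvaluesOfL0.

(** Degree-0 derivations are diagonal, and the Leibniz rule on << m >>, << n >>
constrains the eigenvalues only when << m >> and << n >> do not commute. *)
Lemma degree0_eigenvalues D : derivation_of_degree br 0 D ->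
  exists f : G -> F, (forall m, D << m >> = f m *: << m >>) /\
    (forall m n, c m n != 0 -> f (m + n) = f m + f n).
Proof.
move=> [[lD dD] degD]; pose f m := (D << m >>)@_m; exists f.
have DL m : D << m >> = f m *: << m >>.
  by rewrite /f; have [a ->] := degD m; rewrite addr0 mcoeffZ mcoeffUU mulr1.
split=> // m n cmn; have := congr1 (mcoeff (m + n)) (dD << m >> << n >>).
rewrite br_basis (linear_scale lD) !DL.
rewrite (linear_scale (ll _)) (linear_scale (lr _)) br_basis -scalerDl.
rewrite !mcoeffZ !mcoeffUU !mulr1 mulrC.
exact: mulIf.
Qed.

Lemma degree0_span (I : finType) (phi : I -> G -> F) :
  (forall i, {morph phi i : m n / m + n}) ->
  (forall D, derivation_of_degree br 0 D ->
     exists a : I -> F, forall m,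
       D << m >> = (\sum_i a i * phi i m) *: << m >>) ->
  derivation_of_degree br 0 = lspan (range (fun i => diagonal (phi i))).
Proof.
move=> phiD coord; apply/seteqP; split=> [D degD|]; last first.
  apply: lspan_sub (derivation_of_degree_subspace 0) _ => _ [i _ <-].
  exact: diagonal_degree0.
have [a Da] := coord D degD; have [[lD _] _] := degD.
suff -> : D = \sum_i a i *: diagonal (phi i) by exact: lspan_sum.
apply: linear_basis_ext => // [b x y|m].
  rewrite fct_sumE scaler_sumr -big_split; apply: eq_bigr => i _ /=.
  by rewrite !fctE /diagonal malg_linear_linear scalerDr !scalerA mulrC.
rewrite Da fct_sumE scaler_suml; apply: eq_bigr => i _.
by rewrite fctE /diagonal malg_linearU scalerA.
Qed.

End GradedLieAlgebra.

(** * The Lie algebra of gamma and Q *)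

Section Torus.
Context {R : realType} {d : nat} {gamma : 'rV[R[i]]_d} {Q : 'M[R[i]]_d}.
Hypothesis Qinv : forall i j, Q i j * Q j i = 1.
Hypothesis gamma_generic : generic gamma.

Local Notation Zd := 'rV[int]_d.
Local Notation s := (sigma Q).
Local Notation p := (pairing gamma).
Local Notation c := (bracket_coef gamma Q).
Local Notation r := (radical Q).
Implicit Types (m n k : Zd).

Lemma pairing_inj : injective p.
Proof.
move=> m n pmn; apply/rowP => i; apply/eqP; rewrite -subr_eq0.
rewrite -(inj_eq (@intr_inj rat)); apply/eqP; move: i.
apply: gamma_generic.
transitivity (p m - p n); last by rewrite pmn subrr.
rewrite -sumrB; apply: eq_bigr => j _.
by rewrite ratr_int rmorphB /= mulrBl ![_ * gamma 0 j]mulrC.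
Qed.

Lemma pairing_neq0 n : n != 0 -> p n != 0.
Proof.
apply: contra_neq => pn0; apply: pairing_inj; apply: (@addIr _ (p n)).
by rewrite /= -[RHS]Defs.pairingD add0r pn0 addr0.
Qed.

Lemma sigma0l n : s 0 n = 1.
Proof.
rewrite /sigma big1 // => i _; rewrite big1 // => j _.
by rewrite mxE mul0r expr0z.
Qed.

Lemma sigma0r n : s n 0 = 1.
Proof.
rewrite /sigma big1 // => i _; rewrite big1 // => j _.
by rewrite mxE mulr0 expr0z.
Qed.

Lemma radical0 : 0 \in r.
Proof. by apply/Defs.radicalP => n; rewrite sigma0l sigma0r. Qed.

Lemma coef0l n : c 0 n = p n.
Proof. by rewrite /bracket_coef radical0 sigma0l mul1r subr0 mul1r if_same. Qed.

(** The hypotheses of [partially_additive] for beta m n = s m n / s n m, whose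
radical is R. For m in R, c m n vanishes only if m = n, which leaves doubles to
be treated apart. As c 0 0 = 0, a nonzero n, hence d > 0, is needed to get
f 0 = 0 from f (0 + n) = f 0 + f n. *)
Lemma coef_additive (f : Zd -> R[i]) : (0 < d)%N ->
  (forall m n, c m n != 0 -> f (m + n) = f m + f n) -> {morph f : m n / m + n}.
Proof.
move=> d_gt0 fD.
have s0 := Defs.sigma_neq0 Qinv.
have f0 : f 0 = 0.
  pose e : Zd := 'e_(Ordinal d_gt0).
  have e0 : e != 0.
    by apply/eqP => /rowP/(_ (Ordinal d_gt0)); rewrite !mxE !eqxx.
  have := fD 0 e; rewrite coef0l pairing_neq0 // add0r => /(_ isT).
  by rewrite -{1}[f e]add0r => /addIr.
have fRR m n : m \in r -> n \in r -> p m != p n -> f (m + n) = f m + f n.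
  move=> mr nr mn; apply: fD; rewrite /bracket_coef mr nr mulf_neq0 //.
  by rewrite Defs.pairingD Defs.pairingN subr_eq0 eq_sym.
have beta1 m n : (s m n / s n m = 1) <-> (s m n = s n m).
  by split=> [/divr1_eq|->]; rewrite ?mulfV.
apply: (partially_additive (fun m n => s m n / s n m)).
- by move=> t m n /=; rewrite Defs.sigmaDl // Defs.sigmaDr // invfM mulrACA.
- by move=> t m n /=; rewrite Defs.sigmaDl // Defs.sigmaDr // invfM mulrACA.
- by move=> m; rewrite mulfV.
- move=> m n /beta1 smn; apply: fD; rewrite /bracket_coef.
  case: ifPn => [/Defs.radicalP/(_ n)//|_].
  case: ifPn => [/Defs.radicalP/(_ m)/esym//|_].
  by rewrite subr_eq0; apply/eqP.
move=> m n mr; have {}mr : m \in r by apply/Defs.radicalP => t; apply/beta1.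
have [nr|nr] := boolP (n \in r); last first.
  apply: fD; rewrite /bracket_coef mr (negPf nr) mulf_neq0 ?pairing_neq0 //.
  by apply: contraNneq nr => ->; exact: radical0.
(* c m m = 0: f (m + m) is reached through m = (m + m) - m instead *)
have [<-|mn] := eqVneq m n; last first.
  by apply: fRR => //; rewrite (inj_eq pairing_inj).
have [->|m0] := eqVneq m 0; first by rewrite addr0 f0 addr0.
have mNr : - m \in r by rewrite -(Defs.radicalDl Qinv (- m) mr) subrr radical0.
have mmr : m + m \in r by rewrite (Defs.radicalDl Qinv m mr).
have fN : f m + f (- m) = 0.
  rewrite -fRR ?subrr // Defs.pairingN -subr_eq0 opprK -mulr2n.
  by rewrite mulrn_eq0 pairing_neq0.
have fmm : f (m + m) + f (- m) = f m.
  rewrite -fRR ?addrK // Defs.pairingN Defs.pairingD -subr_eq0 opprK.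
  by rewrite -mulr2n -mulrSr mulrn_eq0 pairing_neq0.
by apply: (@addIr _ (f (- m))); rewrite /= fmm -addrA fN addr0.
Qed.

End Torus.

Theorem theorem3p1 (R : realType) (d : nat)
    (gamma : 'rV[R[i]]_d) (Q : 'M[R[i]]_d)
    (hd : (1 < d)%N)
    (hQ1 : forall i, Q i i = 1)
    (hQ : forall i j, Q i j * Q j i = 1)
    (hgamma : generic gamma) :
  is_direct_sum (Der gamma Q) (Der_deg gamma Q) /\
  forall n : 'rV[int]_d,
    Der_deg gamma Q n =
      if n == 0 then lspan (range (@partial R d))
      else lspan [set ad gamma Q (L n)].
Proof.
have lie := bracket_lie gamma hQ; have basis := bracket_L gamma Q.
have pD := Defs.pairingD gamma; have p_inj := pairing_inj hgamma.
have c0 := @coef0l R d gamma Q.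
split; first exact: (derivation_direct_sum lie basis pD p_inj c0).
move=> n; case: eqVneq => [->|n0]; last first.
  exact: (degree_neq0_span lie basis pD p_inj c0).
have deg0 := degree0_span lie basis _ (fun i (m : 'rV[int]_d) => (m 0 i)%:~R).
apply: deg0.
  by move=> i m k; rewrite mxE rmorphD.
move=> D /(degree0_eigenvalues lie basis)[f [Df]].
move=> /(coef_additive hQ hgamma f (ltnW hd)) fD.
exists (fun i => f 'e_i) => m; rewrite Df (additive_coordinates fD).
by under eq_bigr do rewrite -mulrzr.
Qed.
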